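(* Let $X$ and $Y$ be Banach spaces. If $(X,Y)$ has property strict $(sM^* )$, then $(Y^*,X^* )$ has the weak* to weak* maximizing property (weak*-to-weak*MP).
   Context: The scalar field is $\mathbb{R}$ or $\mathbb{C}$; $\mathcal{L}(X,Y)$ is the Banach space of bounded linear operators; a contraction is an operator of norm at most $1$. A contraction $T\in\mathcal{L}(X,Y)$ has property strict $(sM^* )$ if whenever $x^*\in X^*$ and $y^*\in Y^*$ satisfy $\|y^*\|>\|x^*\|$, then $\limsup_\alpha\|x^*+T^*y^*_\alpha\|<\limsup_\alpha\|y^*+y^*_\alpha\|$ for every bounded weakly* null net $(y^*_\alpha)\subset Y^*$. The pair $(X,Y)$ has property strict $(sM^* )$ if every contraction in $\mathcal{L}(X,Y)$ has it. For $T\in\mathcal{L}(X,Y)$, a maximizing sequence of the adjoint $T^*$ is a sequence $(y_n^* )$ in the closed unit ball $B_{Y^*}$ with $\lim_n\|T^*y_n^*\|=\|T^*\|$, and $T^*$ attains its norm if $\|T^*y^*\|=\|T^*\|$ for some $y^*$ in the unit sphere of $Y^*$. The pair $(Y^*,X^* )$ has the weak*-to-weak*MP if for every $T\in\mathcal{L}(X,Y)$ such that $T^*$ has a maximizing sequence in $B_{Y^*}$ that is not weakly* null, $T^*$ attains its norm. *)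

(* Defs.v *)
From HB Require Import structures.
From mathcomp Require Import all_boot all_order all_algebra.
From mathcomp Require Import all_classical all_reals all_analysis.
From mathcomp Require Import complex.

Set Implicit Arguments.
Unset Strict Implicit.
Unset Printing Implicit Defensive.

Import Order.TTheory GRing.Theory Num.Theory.
Import numFieldNormedType.Exports.

Local Open Scope classical_set_scope.
Local Open Scope ring_scope.

(* Real and complex Banach spaces are treated uniformly: [K] is the scalar
   field and [re : K -> R] its real part, i.e., the identity when [K] is [R]
   and [complex.Re] when [K] is [R[i]].  The map [re] is needed because the norm
   of a normed module over [K] takes its (real) values in [K]. *)

Section Operators.
Context {R : realType} {K : numFieldType} (re : K -> R).

(* L(U, V); for linear maps, boundedness and continuity are the same
   (lemma [linear_bounded_continuous]). *)
Definition bounded_op (U V : normedModType K) : set {linear U -> V} :=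
  [set T | continuous T].
Arguments bounded_op : clear implicits.

(* A real number for bounded operators only: the convention of [sup] on sets
   that are not bounded above is irrelevant below. *)
Definition opnorm (U V : normedModType K) (f : U -> V) : R :=
  sup [set re `|f u| | u in [set u : U | `|u| <= 1]].

Definition dual (U : normedModType K) : set {linear U -> K^o} :=
  bounded_op U K^o.
Arguments dual : clear implicits.

Definition dual_ball (U : normedModType K) : set {linear U -> K^o} :=
  [set u' | dual U u' /\ opnorm u' <= 1].
Arguments dual_ball : clear implicits.

Definition dual_sphere (U : normedModType K) : set {linear U -> K^o} :=
  [set u' | dual U u' /\ opnorm u' = 1].

Definition adjoint (X Y : normedModType K) (T : {linear X -> Y})
    (y' : {linear Y -> K^o}) : {linear X -> K^o} :=
  y' \o T.

(* The norm of the adjoint as an operator between the dual spaces. *)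
Definition adjoint_norm (X Y : normedModType K) (T : {linear X -> Y}) : R :=
  sup [set opnorm (adjoint T y') | y' in dual_ball Y].

End Operators.

Arguments bounded_op {K} U V.
Arguments dual {K} U.
Arguments dual_ball {R K} re U.
Arguments dual_sphere {R K} re U.

Section Nets.

Definition directed (I : Type) (le : I -> I -> Prop) : Prop :=
  [/\ inhabited I,
      forall i, le i i,
      forall i j k, le i j -> le j k -> le i k &
      forall i j, exists k, le i k /\ le j k].

Definition net_filter (I : Type) (le : I -> I -> Prop) : set_system I :=
  [set A | exists i0, forall i, le i0 i -> A i].

Definition net_limsup (R : realType) (I : Type) (le : I -> I -> Prop)
    (a : I -> R) : \bar R :=
  ereal_inf [set ereal_sup [set (a i)%:E | i in [set i | le i0 i]]
            | i0 in [set: I]].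

End Nets.

Section MaximizingProperty.
Context {R : realType} {K : numFieldType} (re : K -> R).

Definition bounded_net (U : normedModType K) (I : Type)
    (u' : I -> {linear U -> K^o}) : Prop :=
  exists M : R, forall i, opnorm re (u' i) <= M.

Definition weakstar_null (U : normedModType K) (I : Type) (F : set_system I)
    (u' : I -> {linear U -> K^o}) : Prop :=
  forall u : U, u' i u @[i --> F] --> (0 : K^o).

Definition has_strict_sMstar (X Y : normedModType K) (T : {linear X -> Y}) :
    Prop :=
  forall (x' : {linear X -> K^o}) (y' : {linear Y -> K^o}),
    dual X x' -> dual Y y' -> opnorm re x' < opnorm re y' ->
  forall (I : Type) (le : I -> I -> Prop) (z' : I -> {linear Y -> K^o}),
    directed le -> (forall i, dual Y (z' i)) ->
    bounded_net z' -> weakstar_null (net_filter le) z' ->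
  (net_limsup le (fun i => opnorm re (x' \+ adjoint T (z' i))%R) <
   net_limsup le (fun i => opnorm re (y' \+ z' i)%R))%E.

Definition pair_strict_sMstar (X Y : normedModType K) : Prop :=
  forall T : {linear X -> Y}, bounded_op X Y T -> opnorm re T <= 1 ->
  has_strict_sMstar T.

Definition maximizing_sequence (X Y : normedModType K) (T : {linear X -> Y})
    (y' : nat -> {linear Y -> K^o}) : Prop :=
  (forall n, dual_ball re Y (y' n)) /\
  opnorm re (adjoint T (y' n)) @[n --> \oo] --> adjoint_norm re T.

Definition adjoint_attains_norm (X Y : normedModType K)
    (T : {linear X -> Y}) : Prop :=
  exists2 y' : {linear Y -> K^o}, dual_sphere re Y y' &
    opnorm re (adjoint T y') = adjoint_norm re T.

(* Indexed by (X, Y), but a property of the pair of duals of Y and X: only the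
   adjoints of operators from X to Y are considered. *)
Definition weakstar_to_weakstar_MP (X Y : normedModType K) : Prop :=
  forall T : {linear X -> Y}, bounded_op X Y T ->
  (exists2 y' : nat -> {linear Y -> K^o}, maximizing_sequence T y' &
     ~ weakstar_null \oo y') ->
  adjoint_attains_norm T.

End MaximizingProperty.

(* Main.v *)
Require Import Defs.
From HB Require Import structures.
From mathcomp Require Import all_boot all_order all_algebra.
From mathcomp Require Import all_classical all_reals all_analysis.
From mathcomp Require Import complex ring lra.

Set Implicit Arguments.
Unset Strict Implicit.
Unset Printing Implicit Defensive.

Import Order.TTheory GRing.Theory Num.Theory.
Import numFieldNormedType.Exports.

Local Open Scope classical_set_scope.
Local Open Scope ring_scope.

(** Let T be a bounded operator, y_n a maximizing sequence of the adjoint T' in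
    the dual ball that is not weakly* null, and s the norm of T'.  An
    ultrafilter that refines convergence to infinity and along which y_n does
    not tend weakly* to 0 yields, by weak* compactness of the dual ball, a weak*
    limit g <> 0 in the dual ball.  Write y_n = g + z_n with z_n bounded and
    weakly* null along the ultrafilter.

    If T' did not attain its norm, then |T' g| < s |g|: otherwise g / |g| would
    be a point where the norm is attained.  In particular s > 0.  The operator
    S = T / s is a contraction, because |T| <= |T'|, and |S' g| < |g|.  Strict
    (sM-star) for S, applied to the functionals S' g and g and to the net z, gives
      1 = lim |S' y_n| = limsup |S' g + S' z_n| < limsup |g + z_n|
        = limsup |y_n| <= 1,
    a contradiction ([strict_sMstar_MP]).

    Three ingredients support this.  The inequality |T| <= |T'| is the
    Hahn-Banach theorem ([supporting_functional], [norming_functional]),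
    obtained here from minimal sublinear functionals.  Weak* compactness reduces
    to the convergence of bounded scalar sequences along ultrafilters
    ([dual_ball_ultra_cvg]).  Finally, a filter is turned into a net by pointing
    its members ([pointed_member]).

    Both scalar fields are handled at once: [real_part_of] isolates the
    properties of a field K over R that the argument uses, and they are checked
    for K = R and K = R[i] at the end. *)

(** * Sublinear functionals and the Hahn-Banach theorem *)

Section HahnBanach.
Context {R : realType} {K : nzRingType} (c : {rmorphism R -> K}).
Context {E : lmodType K}.
Implicit Types (q p : E -> R) (x y : E).

(** Scalars are restricted from K to R along [c], so that real functionals on a
    complex space are covered without a second module structure on it.
    Homogeneity is one-sided because inequalities pass to infima; equality
    follows ([sublinearZ]). *)
Definition sublinear q :=
  (forall x y, q (x + y) <= q x + q y) /\
  (forall (r : R) x, 0 <= r -> q (c r *: x) <= r * q x).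

Lemma sublinear0 q : sublinear q -> q 0 = 0.
Proof.
move=> [qD qZ]; apply/eqP; rewrite eq_le.
have := qZ 0 0 (lexx _); rewrite rmorph0 scale0r mul0r => ->/=.
by have := qD 0 0; rewrite addr0; lra.
Qed.

Lemma sublinearZ q (r : R) x : sublinear q -> 0 <= r -> q (c r *: x) = r * q x.
Proof.
move=> qs r0; have [->|rn0] := eqVneq r 0.
  by rewrite rmorph0 scale0r mul0r sublinear0.
have rp : 0 < r by rewrite lt_def rn0.
apply/eqP; rewrite eq_le qs.2//= -ler_pdivlMl//.
have := qs.2 r^-1 (c r *: x); rewrite invr_ge0 => /(_ r0).
by rewrite scalerA -rmorphM mulVf// rmorph1 scale1r.
Qed.

Lemma sublinear_geN q x : sublinear q -> - q (- x) <= q x.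
Proof. by move=> qs; have := qs.1 x (- x); rewrite subrr sublinear0//; lra. Qed.

(** For sublinear [q], the largest sublinear functional below [q] whose value at
    [- y] is [- q y]. *)
Definition flatten_along q y x : R :=
  inf [set q (x + c t *: y) - t * q y | t in [set t : R | 0 <= t]].

(** The infimum is that of a set bounded below, since
    t q(y) = q(t y) <= q(x + t y) + q(- x). *)
Lemma flatten_along_le q y x t : sublinear q -> 0 <= t ->
  flatten_along q y x <= q (x + c t *: y) - t * q y.
Proof.
move=> qs t0; apply: ge_inf; last by exists t.
exists (- q (- x)) => _ [s s0 <-].
have := sublinearZ y qs s0; have := qs.1 (x + c s *: y) (- x).
by rewrite addrAC subrr add0r; lra.
Qed.

Lemma flatten_along_ge q y x b :
  (forall t : R, 0 <= t -> b <= q (x + c t *: y) - t * q y) ->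
  b <= flatten_along q y x.
Proof.
move=> bq; apply: lb_le_inf; first by eexists; exists 0 => //=; exact: lexx.
by move=> _ [t t0 <-]; exact: bq.
Qed.

Lemma flatten_along_sublinear q y :
  sublinear q -> sublinear (flatten_along q y).
Proof.
move=> qs; have [qD qZ] := qs; split=> [x1 x2|r x r0].
  rewrite -lerBlDl; apply: flatten_along_ge => t2 t20.
  rewrite lerBlDl -lerBlDr; apply: flatten_along_ge => t1 t10.
  have := flatten_along_le y (x1 + x2) qs (addr_ge0 t10 t20).
  have := qD (x1 + c t1 *: y) (x2 + c t2 *: y).
  by rewrite rmorphD scalerDl addrACA mulrDl; lra.
have [->|rn0] := eqVneq r 0.
  rewrite rmorph0 scale0r mul0r.
  have := flatten_along_le y 0 qs (lexx 0).
  by rewrite rmorph0 scale0r addr0 (sublinear0 qs) mul0r subr0.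
have rp : 0 < r by rewrite lt_def rn0.
rewrite -ler_pdivrMl//; apply: flatten_along_ge => t t0.
rewrite ler_pdivrMl//.
apply: le_trans (flatten_along_le y (c r *: x) qs (mulr_ge0 r0 t0)) _.
have := qZ r (x + c t *: y) r0.
by rewrite scalerDr scalerA -rmorphM/=; lra.
Qed.

Lemma flatten_along_le_self q y x : sublinear q -> flatten_along q y x <= q x.
Proof.
move=> qs; have := flatten_along_le y x qs (lexx 0).
by rewrite rmorph0 scale0r addr0 mul0r subr0.
Qed.

(** Zorn's lemma: the pointwise infimum of a chain of sublinear functionals
    below [p] is finite because each of them is at least [- p (- x)] at [x], and
    it is subadditive because two members of a chain can be replaced by the
    smaller one. *)
Lemma minimal_sublinear p : sublinear p -> exists2 q, sublinear q /\
  (forall x, q x <= p x) &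
  forall q', sublinear q' -> (forall x, q' x <= q x) -> q' = q.
Proof.
move=> ps.
pose T := {q : E -> R | sublinear q /\ forall x, q x <= p x}.
(* The order is reversed: Zorn's lemma yields maximal elements. *)
pose le (s t : T) : bool := `[< forall x, sval t x <= sval s x >].
have [//||||m mmax] := @Zorn T le.
- by move=> t; apply/asboolP.
- move=> r s t /asboolP rs /asboolP st; apply/asboolP => x.
  exact: le_trans (st x) (rs x).
- move=> [s hs] [t ht] /asboolP/= st /asboolP/= ts; apply: eq_exist.
  by apply/funext => x; apply/eqP; rewrite eq_le st ts.
- move=> A Atot.
  have [[a Aa]|A0] := pselect (exists a, A a); last first.
    by exists (exist _ p (conj ps (fun=> lexx _))) => s As; case: A0; exists s.
  pose q x := inf [set sval s x | s in A].
  have q_le s x : A s -> q x <= sval s x.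
    move=> As; apply: ge_inf; last by exists s.
    exists (- p (- x)) => _ [t _ <-]; case: t => t [ts tp]/=.
    by apply: le_trans (sublinear_geN x ts); rewrite lerN2.
  have le_q b x : (forall s, A s -> b <= sval s x) -> b <= q x.
    move=> bs; apply: lb_le_inf; first by exists (sval a x), a.
    by move=> _ [s As <-]; exact: bs.
  have qs : sublinear q.
    split=> [x y|r x r0].
      rewrite -lerBlDl; apply: (le_q _ _) => t At; rewrite lerBlDl -lerBlDr.
      apply: (le_q _ _) => s As; rewrite lerBlDr.
      have [/asboolP st|/asboolP ts] := Atot _ _ As At.
        apply: le_trans (q_le t _ At) _; case: (svalP t) => -[tD _] _.
        by apply: le_trans (tD _ _) _; rewrite lerD2r.
      apply: le_trans (q_le s _ As) _; case: (svalP s) => -[sD _] _.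
      by apply: le_trans (sD _ _) _; rewrite lerD2l.
    have [->|rn0] := eqVneq r 0.
      rewrite rmorph0 scale0r mul0r; apply: le_trans (q_le a _ Aa) _.
      by case: (svalP a) => /sublinear0 -> _.
    have rp : 0 < r by rewrite lt_def rn0.
    rewrite -ler_pdivrMl//; apply: (le_q _ _) => t At; rewrite ler_pdivrMl//.
    by apply: le_trans (q_le t _ At) _; case: (svalP t) => -[_ tZ] _; exact: tZ.
  have qp x : q x <= p x.
    by apply: le_trans (q_le a _ Aa) _; case: (svalP a).
  by exists (exist _ q (conj qs qp)) => s As; apply/asboolP => x; exact: q_le.
exists (sval m); first exact: (svalP m).
move=> q qs qm.
have qp x : q x <= p x by apply: le_trans (qm x) _; case: (svalP m).
by rewrite -(mmax (exist _ q (conj qs qp)))//; exact/asboolP.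
Qed.

(** By minimality, flattening [q] along [y] leaves [q] unchanged, and the
    infimum evaluated at t = 1 then reads q(x) + q(y) <= q(x + y). *)
Lemma minimal_sublinear_linear q : sublinear q ->
  (forall q', sublinear q' -> (forall x, q' x <= q x) -> q' = q) ->
  {morph q : x y / x + y} /\ forall r x, q (c r *: x) = r * q x.
Proof.
move=> qs qmin.
have qD : {morph q : x y / x + y}.
  move=> x y; apply/eqP; rewrite eq_le qs.1/= -lerBrDr.
  have := flatten_along_le y x qs ler01; rewrite rmorph1 scale1r mul1r.
  have -> : flatten_along q y = q.
    apply: qmin; first exact: flatten_along_sublinear.
    by move=> z; exact: flatten_along_le_self.
  by [].
have qN x : q (- x) = - q x.
  by have := qD x (- x); rewrite subrr sublinear0//; lra.
have qZ (r : R) x : 0 <= r -> q (c r *: x) = r * q x by exact: sublinearZ.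
split=> // r x; have [/qZ//|r0] := leP 0 r.
have := qZ (- r) x; rewrite oppr_ge0 ltW// => /(_ isT).
by rewrite rmorphN scaleNr qN; lra.
Qed.

(** A minimal sublinear functional below the flattening of [p] along [v] is
    linear and at most [- p v] at [- v], hence at least [p v] at [v]. *)
Lemma supporting_functional p v : sublinear p -> exists f : E -> R,
  [/\ {morph f : x y / x + y}, forall r x, f (c r *: x) = r * f x,
      forall x, f x <= p x & f v = p v].
Proof.
move=> ps.
have [f [fs fp] fmin] := minimal_sublinear (flatten_along_sublinear v ps).
have [fD fZ] := minimal_sublinear_linear fs fmin.
have f_le x : f x <= p x.
  exact: le_trans (fp x) (flatten_along_le_self v x ps).
exists f; split=> //; apply/eqP; rewrite eq_le f_le/=.
have := fZ (-1) v; rewrite rmorphN1 scaleN1r mulN1r.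
have := le_trans (fp (- v)) (flatten_along_le v (- v) ps ler01).
by rewrite rmorph1 scale1r addNr (sublinear0 ps) mul1r; lra.
Qed.

End HahnBanach.

(** * Norms over R or R[i] as real numbers *)

(** What R and R[i] have in common.  The last two fields carry the substance:
    local compactness of the scalars, and the passage from a real-linear
    functional to a K-linear one of which it is the real part. *)
Record real_part_of (R : realType) (K : numFieldType) (re : K -> R)
    (c : {rmorphism R -> K}) : Prop := RealPart {
  real_partK : cancel c re;
  real_part_ge0K : forall z : K, 0 <= z -> c (re z) = z;
  real_embed_mono : {mono c : r s / r <= s};
  real_part_le_norm : forall z, re z <= re `|z|;
  bounded_ultra_cvg : forall (F : set_system nat) (u : nat -> K) (M : R),
    UltraFilter F -> (forall n, `|u n| <= c M) ->
    exists l : K^o, (u n : K^o) @[n --> F] --> l;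
  linear_of_real_part : forall (E : lmodType K) (f : E -> R),
    {morph f : x y / x + y} -> (forall r x, f (c r *: x) = r * f x) ->
    exists g : {linear E -> K^o}, forall x, re (g x) = f x }.

Section RealNorm.
Context {R : realType} {K : numFieldType} {re : K -> R}.
Context {c : {rmorphism R -> K}}.
Context (rc : real_part_of re c).
Implicit Types (U V X Y : normedModType K).

Lemma re_normK V (x : V) : c (re `|x|) = `|x|.
Proof. exact/(real_part_ge0K rc)/normr_ge0. Qed.

Lemma re_norm_le_real V (x : V) (M : R) : (re `|x| <= M) = (`|x| <= c M).
Proof. by rewrite -(real_embed_mono rc) re_normK. Qed.

Lemma re_norm_ge0 V (x : V) : 0 <= re `|x|.
Proof. by rewrite -(real_embed_mono rc) re_normK rmorph0. Qed.

Lemma re_norm_triangle V (x y : V) : re `|x + y| <= re `|x| + re `|y|.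
Proof.
by rewrite re_norm_le_real rmorphD !re_normK ler_normD.
Qed.

Lemma re_normZ V (k : K) (x : V) : re `|k *: x| = re `|k| * re `|x|.
Proof.
by apply: (can_inj (real_partK rc)); rewrite rmorphM !re_normK normrZ.
Qed.

Lemma re_norm_real (r : R) : re `|c r| = `|r|.
Proof.
have posE s : 0 <= s -> re `|c s| = s.
  move=> s0; rewrite ger0_norm ?(real_partK rc)//.
  by rewrite -(rmorph0 c) (real_embed_mono rc).
have [r0|r0] := leP 0 r; first by rewrite posE// ger0_norm.
by rewrite -normrN -rmorphN posE ?oppr_ge0 ?ltW// ltr0_norm.
Qed.

Lemma re_norm_eq0 V (x : V) : re `|x| = 0 -> x = 0.
Proof.
by move=> x0; apply/eqP; rewrite -normr_eq0 -re_normK x0 rmorph0.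
Qed.

Lemma unit_ballE V (x : V) : (`|x| <= 1) = (re `|x| <= 1).
Proof. by rewrite re_norm_le_real rmorph1. Qed.

Lemma continuous_of_bound U V (f : {linear U -> V}) (M : R) :
  (forall u, re `|f u| <= M * re `|u|) -> continuous f.
Proof.
move=> fM; apply/linear_bounded_continuous/linear_boundedP.
exists (c M); split=> [|r Mr x].
  rewrite realE -(rmorph0 c) !(real_embed_mono rc); exact: le_total.
have := fM x; rewrite re_norm_le_real rmorphM re_normK => /le_trans; apply.
by rewrite ler_wpM2r// ltW.
Qed.

Lemma bound_of_continuous U V (f : {linear U -> V}) :
  continuous f -> exists M : R, forall u, re `|f u| <= M * re `|u|.
Proof.
move=> /linear_bounded_continuous/linear_boundedP[r [rreal fr]].
exists (re (`|r| + 1)) => u.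
have r1 : 0 <= `|r| + 1 by rewrite addr_ge0.
rewrite re_norm_le_real rmorphM re_normK (real_part_ge0K rc)//; apply: fr.
by rewrite (le_lt_trans (real_ler_norm rreal))// ltrDl.
Qed.

Lemma opnorm_le U V (f : {linear U -> V}) (M : R) :
  (forall u, re `|u| <= 1 -> re `|f u| <= M) -> opnorm re f <= M.
Proof.
move=> fM; apply: ge_sup.
  by exists (re `|f 0|), 0 => //=; rewrite normr0 ler01.
by move=> _ [u /= u1 <-]; apply: fM; rewrite -unit_ballE.
Qed.

Lemma le_opnorm1 U V (f : {linear U -> V}) u :
  continuous f -> re `|u| <= 1 -> re `|f u| <= opnorm re f.
Proof.
move=> /bound_of_continuous[M fM] u1; apply: ub_le_sup; last first.
  by exists u => //=; rewrite unit_ballE.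
exists `|M| => _ [v /= v1 <-]; apply: le_trans (fM v) _.
rewrite unit_ballE in v1.
apply: le_trans (ler_wpM2r (re_norm_ge0 v) (ler_norm M)) _.
by rewrite ler_piMr.
Qed.

Lemma opnorm_ge0 U V (f : {linear U -> V}) : continuous f -> 0 <= opnorm re f.
Proof.
move=> fc; apply: le_trans (re_norm_ge0 (f 0)) (le_opnorm1 fc _).
by rewrite -unit_ballE normr0.
Qed.

Lemma le_opnorm U V (f : {linear U -> V}) u :
  continuous f -> re `|f u| <= opnorm re f * re `|u|.
Proof.
move=> fc; have [u0|u0] := eqVneq (re `|u|) 0.
  rewrite (re_norm_eq0 u0) linear0 !normr0.
  by rewrite -(rmorph0 c) (real_partK rc) mulr0.
have up : 0 < re `|u| by rewrite lt_def u0 re_norm_ge0.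
rewrite -ler_pdivrMr// mulrC.
have := @le_opnorm1 _ _ f (c (re `|u|)^-1 *: u) fc.
rewrite linearZ/= !re_normZ re_norm_real gtr0_norm ?invr_gt0// mulVf//.
by apply.
Qed.

Lemma opnorm_le_mul U V (f : {linear U -> V}) (M : R) : 0 <= M ->
  (forall u, re `|f u| <= M * re `|u|) -> opnorm re f <= M.
Proof.
move=> M0 fM; apply: opnorm_le => u u1.
by apply: le_trans (fM u) _; rewrite ler_piMr.
Qed.

Lemma opnormZ U V (f : {linear U -> V}) (r : R) : continuous f -> 0 < r ->
  opnorm re (c r \*: f) = r * opnorm re f.
Proof.
move=> fc r0; have rfE u : re `|(c r \*: f) u| = r * re `|f u|.
  by rewrite /= re_normZ re_norm_real gtr0_norm.
apply/eqP; rewrite eq_le; apply/andP; split.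
  apply: opnorm_le => u u1; rewrite rfE ler_pM2l//; exact: le_opnorm1.
have rfc : continuous (c r \*: f).
  apply: (@continuous_of_bound _ _ _ (r * opnorm re f)) => u.
  by rewrite rfE -mulrA ler_pM2l//; exact: le_opnorm.
rewrite -ler_pdivlMl//; apply: opnorm_le => u u1.
by rewrite ler_pdivlMl// -rfE; exact: le_opnorm1.
Qed.

Lemma continuousZ_op U V (f : {linear U -> V}) (r : R) : continuous f ->
  continuous (c r \*: f).
Proof.
move=> fc; apply: (@continuous_of_bound _ _ _ (`|r| * opnorm re f)) => u.
by rewrite /= re_normZ re_norm_real -mulrA ler_wpM2l//; exact: le_opnorm.
Qed.

(** * Duality: the norm of the adjoint and weak* compactness *)

(** The real functional supporting the norm at [v] is the real part of some
    linear [g].  Multiplying [x] by the unimodular scalar that makes [g x] real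
    and nonnegative, one sees that [g] obeys the same bound as its real part. *)
Lemma norming_functional Y (v : Y) :
  exists2 g : {linear Y -> K^o}, dual_ball re Y g & re `|v| <= re `|g v|.
Proof.
have ps : sublinear c (fun x : Y => re `|x|).
  split=> [x y|r x r0]; first exact: re_norm_triangle.
  by rewrite re_normZ re_norm_real ger0_norm.
have [f [fD fZ f_le fv]] := supporting_functional v ps.
have [g gf] := linear_of_real_part rc fD fZ.
have g_le x : re `|g x| <= 1 * re `|x|.
  rewrite mul1r; have [->|gx0] := eqVneq (g x) 0.
    by rewrite normr0 -(rmorph0 c) (real_partK rc) re_norm_ge0.
  pose k : K := `|g x| / g x.
  have k1 : `|k| = 1 by rewrite normrM normfV normr_id divff// normr_eq0.
  have <- : re `|k *: x| = re `|x| by rewrite normrZ k1 mul1r.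
  by apply: le_trans (f_le _); rewrite -gf linearZ/= /GRing.scale/= divfK.
have gc : continuous g by apply: continuous_of_bound g_le.
exists g; last by rewrite -fv -gf; exact: (real_part_le_norm rc).
split; first exact: gc.
exact: opnorm_le_mul g_le.
Qed.

Lemma adjoint_continuous X Y (T : {linear X -> Y}) (y' : {linear Y -> K^o}) :
  continuous T -> continuous y' -> continuous (adjoint T y').
Proof. by move=> Tc yc x; apply: continuous_comp; [exact: Tc|exact: yc]. Qed.

Lemma le_adjoint_norm X Y (T : {linear X -> Y}) (y' : {linear Y -> K^o}) :
  continuous T -> dual_ball re Y y' ->
  opnorm re (adjoint T y') <= adjoint_norm re T.
Proof.
move=> Tc y'1; apply: ub_le_sup; last by exists y'.
exists (opnorm re T) => _ [z' [zc z1] <-]; apply: opnorm_le => u u1.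
apply: le_trans (le_opnorm (T u) zc) _.
apply: le_trans (ler_wpM2r (re_norm_ge0 _) z1) _.
by rewrite mul1r; exact: le_opnorm1.
Qed.

Lemma opnorm_le_adjoint_norm X Y (T : {linear X -> Y}) :
  continuous T -> opnorm re T <= adjoint_norm re T.
Proof.
move=> Tc; apply: opnorm_le => u u1.
have [g g1 Tu] := norming_functional (T u).
apply: le_trans Tu (le_trans _ (le_adjoint_norm Tc g1)).
apply: (le_opnorm1 (f := adjoint T g)) => //.
exact: adjoint_continuous Tc g1.1.
Qed.

(** The Banach-Alaoglu theorem in the form needed for sequences: the pointwise
    limits along an ultrafilter exist because the scalars are locally compact,
    and linearity and the norm bound pass to the limit. *)
Lemma dual_ball_ultra_cvg Y (y' : nat -> {linear Y -> K^o})
    (F : set_system nat) : UltraFilter F -> (forall n, dual_ball re Y (y' n)) ->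
  exists2 g : {linear Y -> K^o}, dual_ball re Y g &
    forall u, y' n u @[n --> F] --> g u.
Proof.
move=> FU y'1.
have y'_le n u : re `|y' n u| <= re `|u|.
  have [yc y1] := y'1 n; apply: le_trans (le_opnorm u yc) _.
  by rewrite -[leRHS]mul1r ler_wpM2r// re_norm_ge0.
have /choice[h hP] u : exists l : K^o, y' n u @[n --> F] --> l.
  apply: (bounded_ultra_cvg rc (M := re `|u|)) => n.
  by rewrite -re_norm_le_real.
have hlin : linear h.
  move=> a u v; apply: (cvg_unique (@norm_hausdorff K K^o) (hP _)).
  have -> : (fun n => y' n (a *: u + v)) = (fun n => a *: y' n u + y' n v).
    by apply/funext => n; exact: linearP.
  by apply: cvgD; [apply: cvgZl_tmp; exact: hP|exact: hP].
pose hL := GRing.isLinear.Build K Y K^o *:%R h hlin.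
pose g : {linear Y -> K^o} := HB.pack h hL.
have g_le u : re `|g u| <= 1 * re `|u|.
  rewrite mul1r; apply/ler_addgt0Pr => e e0.
  have ce0 : 0 < c e by rewrite -(rmorph0 c) (leW_mono (real_embed_mono rc)).
  have /cvgrPdist_lt/(_ _ ce0) := hP u.
  move=> /(@filter_ex _ F _)[n] /ltW; rewrite -re_norm_le_real => hn.
  rewrite -[g u](subrK (y' n u)) addrC.
  by apply: le_trans (re_norm_triangle _ _) _; apply: lerD.
have gc : continuous g by apply: continuous_of_bound g_le.
exists g => //; split; first exact: gc.
exact: opnorm_le_mul g_le.
Qed.

End RealNorm.

(** * The net of pointed members of a filter *)

Section FilterNet.
Context {T : Type} (F : set_system T).

(** Under reverse inclusion of the members, the points form a net whose tails
    run exactly through the members, since any element of a member can serve as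
    its point. *)
Definition pointed_member := {p : set T * T | F p.1 /\ p.1 p.2}.

Definition pm_le (i j : pointed_member) := (sval j).1 `<=` (sval i).1.

Definition pm_point (i : pointed_member) := (sval i).2.

Lemma pm_directed : ProperFilter F -> directed pm_le.
Proof.
move=> FF; split.
- have [x _] := filter_ex (@filterT _ F _).
  by constructor; exists (setT, x); split=> //; exact: filterT.
- by move=> i.
- by move=> i j k ij jk; exact: subset_trans jk ij.
- move=> [[A x] /= [FA Ax]] [[B y] /= [FB By]].
  have FAB : F (A `&` B) by exact: filterI.
  have [z ABz] := filter_ex FAB.
  exists (exist _ (A `&` B, z) (conj FAB ABz)); split=> t /= [] //.
Qed.

Lemma pm_net_filter : ProperFilter F -> forall A : set T, F A ->
  net_filter pm_le (pm_point @^-1` A).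
Proof.
move=> FF A FA; have [x Ax] := filter_ex FA.
exists (exist _ (A, x) (conj FA Ax)) => -[[B y] /= [FB By]] BA.
exact: BA.
Qed.

(** A tail starting at a member [A] contains all points of [A], and among them
    points where [a] is close to its limit. *)
Lemma net_limsup_ge (R : realType) (a : T -> R) (l : R) : ProperFilter F ->
  a x @[x --> F] --> l ->
  (l%:E <= net_limsup pm_le (a \o pm_point))%E.
Proof.
move=> FF al; apply: le_ereal_inf_tmp => _ [[[A x0] /= [FA Ax0]] _ <-].
apply/lee_subgt0Pr => e e0.
have /cvgrPdist_lt/(_ _ e0) al_e := al.
have [x [Ax]] := filter_ex (filterI FA al_e : F _).
rewrite /= ltr_norml => /andP[_ le_ax]; apply: le_ereal_sup_tmp.
exists (a x)%:E; last by rewrite -EFinB lee_fin; lra.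
by exists (exist _ (A, x) (conj FA Ax)).
Qed.

End FilterNet.

Lemma net_limsup_le (R : realType) (I : Type) (le : I -> I -> Prop) (a : I -> R)
    (M : R) : directed le -> (forall i, a i <= M) ->
  (net_limsup le a <= M%:E)%E.
Proof.
move=> [[i0] _ _ _] aM.
apply: le_trans (ereal_inf_lbound _) _; first by exists i0.
by apply: ge_ereal_sup => _ [i _ <-]; rewrite lee_fin.
Qed.

(** * The maximizing property *)

Section MaximizingProperty.
Context {R : realType} {K : numFieldType} {re : K -> R}.
Context {c : {rmorphism R -> K}}.
Context (rc : real_part_of re c).

(** Some neighbourhood [B] of [l] is missed infinitely often; an ultrafilter
    containing the set of these indices and all cofinite sets will do. *)
Lemma ultrafilter_avoiding (V : topologicalType) (u : nat -> V) (l : V) :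
  ~ (u n @[n --> \oo] --> l) ->
  exists F : set_system nat, [/\ UltraFilter F, \oo `<=` F &
    ~ (u n @[n --> F] --> l)].
Proof.
move=> /existsNP[B /not_implyP[Bl uB]].
pose A := [set n | ~ B (u n)].
have PA : ProperFilter (within A \oo).
  apply: Build_ProperFilter_ex => P AP; apply: contrapT => P0.
  apply: uB; apply: (filterS _ (AP : \oo _)) => n APn.
  by apply: contrapT => Bn; apply: P0; exists n; exact: APn.
have [F [FU AF]] := ultraFilterLemma PA.
exists F; split=> //.
  by move=> P oP; apply: AF; apply: filterS oP => n Pn _.
move=> ul; have FB : F [set n | B (u n)] by exact: ul.
have FA : F A by apply: AF; exact: withinT.
by have [n []] := filter_ex (filterI FA FB : F _).
Qed.

(** The norm is attained at [g] divided by its norm. *)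
Lemma adjoint_attains_norm_at (X Y : normedModType K) (T : {linear X -> Y})
    (g : {linear Y -> K^o}) :
  continuous T -> continuous g -> 0 < opnorm re g ->
  adjoint_norm re T * opnorm re g <= opnorm re (adjoint T g) ->
  adjoint_attains_norm re T.
Proof.
move=> Tc gc g0 Tg.
pose e : {linear Y -> K^o} := c (opnorm re g)^-1 \*: g.
have e1 : opnorm re e = 1.
  by rewrite (opnormZ rc)// ?invr_gt0// mulVf// gt_eqF.
have ec : continuous e by exact: (continuousZ_op rc).
have eS : dual_sphere re Y e by split.
exists e => //; apply/eqP; rewrite eq_le (le_adjoint_norm rc)//=; last first.
  by split; rewrite // e1.
have -> : opnorm re (adjoint T e) = (opnorm re g)^-1 * opnorm re (adjoint T g).
  rewrite -(opnormZ rc) ?invr_gt0//; exact: adjoint_continuous.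
by rewrite mulrC ler_pdivlMr.
Qed.

Lemma strict_sMstar_MP (X Y : normedModType K) :
  pair_strict_sMstar re X Y -> weakstar_to_weakstar_MP re X Y.
Proof.
move=> sM T Tc [y' [y'1 y'T] /existsNP[u0]].
move=> /ultrafilter_avoiding[F [FU ooF Fu0]].
have [g [gc g1] y'g] := dual_ball_ultra_cvg rc FU y'1.
have g0 : 0 < opnorm re g.
  rewrite lt_def (opnorm_ge0 rc)// andbT; apply/eqP => g_eq0; apply: Fu0.
  have -> : 0 = g u0; last exact: y'g.
  apply/esym/(re_norm_eq0 rc)/le_anti; rewrite (re_norm_ge0 rc) andbT.
  by apply: le_trans (le_opnorm rc _ gc) _; rewrite g_eq0 mul0r.
apply: contrapT => natt.
set s := adjoint_norm re T in y'T.
have Tg_lt : opnorm re (adjoint T g) < s * opnorm re g.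
  rewrite ltNge; apply/negP => Tg_ge; apply: natt.
  exact: adjoint_attains_norm_at gc g0 Tg_ge.
have Tgc : continuous (adjoint T g) by exact: adjoint_continuous.
have s0 : 0 < s.
  by have := le_lt_trans (opnorm_ge0 rc Tgc) Tg_lt; rewrite pmulr_lgt0.
(* Dividing by the norm of the adjoint, not of [T], makes |S' y_n| tend to 1. *)
pose S : {linear X -> Y} := c s^-1 \*: T.
have S1 : opnorm re S <= 1.
  rewrite (opnormZ rc) ?invr_gt0// ler_pdivrMl// mulr1.
  exact: (opnorm_le_adjoint_norm rc).
have Sc : continuous S by exact: (continuousZ_op rc).
have adjS (z : {linear Y -> K^o}) : continuous z ->
    opnorm re (adjoint S z) = s^-1 * opnorm re (adjoint T z).
  move=> zc; rewrite -(opnormZ rc) ?invr_gt0//; last exact: adjoint_continuous.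
  by congr opnorm; apply/funext => x /=; rewrite linearZ.
have Sg_lt : opnorm re (adjoint S g) < opnorm re g.
  by rewrite adjS// ltr_pdivrMl.
have Sgc : continuous (adjoint S g) by exact: adjoint_continuous.
pose z' (i : pointed_member F) : {linear Y -> K^o} := y' (pm_point i) \- g.
have y'c n : continuous (y' n) by case: (y'1 n).
have z'_le i u : re `|z' i u| <= 2 * re `|u|.
  apply: le_trans (re_norm_triangle rc _ _) _; rewrite normrN.
  have [_ y1] := y'1 (pm_point i).
  have := le_trans (le_opnorm rc u (y'c _)) (ler_wpM2r (re_norm_ge0 rc u) y1).
  have := le_trans (le_opnorm rc u gc) (ler_wpM2r (re_norm_ge0 rc u) g1).
  by lra.
have z'c i : continuous (z' i) by apply: (continuous_of_bound rc (z'_le i)).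
have z'b : bounded_net re z'.
  by exists 2 => i; apply: (opnorm_le_mul rc) (z'_le i).
have z'0 : weakstar_null (net_filter (@pm_le _ F)) z'.
  move=> u B B0; apply: (@pm_net_filter _ F _ [set n | B (y' n u - g u)]).
  have : y' n u - g u @[n --> F] --> (0 : K^o).
    by rewrite -(subrr (g u)); apply: cvgB (y'g u) (cvg_cst _).
  exact.
have pmd : directed (@pm_le _ F) by exact: pm_directed.
have := sM S Sc S1 _ _ Sgc gc Sg_lt _ _ z' pmd z'c z'b z'0.
have -> : (fun i => opnorm re (adjoint S g \+ adjoint S (z' i))) =
    (fun n => s^-1 * opnorm re (adjoint T (y' n))) \o @pm_point _ F.
  apply/funext => i /=; rewrite -adjS//; congr opnorm.
  by apply/funext => x /=; rewrite addrC subrK.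
have -> : (fun i => opnorm re (g \+ z' i)) =
    (fun n => opnorm re (y' n)) \o @pm_point _ F.
  apply/funext => i /=; congr opnorm.
  by apply/funext => x /=; rewrite addrC subrK.
apply/negP; rewrite -leNgt; apply: (@le_trans _ _ 1%:E).
  by apply: net_limsup_le pmd _ => i; case: (y'1 (pm_point i)).
apply: net_limsup_ge.
rewrite -(mulVf (lt0r_neq0 s0)); apply: cvgM; first exact: cvg_cst.
by move=> B /y'T/ooF.
Qed.

End MaximizingProperty.

(** * Real and complex scalars *)

Lemma ultra_cvg_bounded_real (R : realType) (F : set_system nat) (u : nat -> R)
    (M : R) : UltraFilter F -> (forall n, `|u n| <= M) ->
  exists l : R, u n @[n --> F] --> l.
Proof.
move=> FU uM.
have uI : (u n @[n --> F]) `[- M, M]%classic.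
  by apply: (@filterE _ F) => n; rewrite /= in_itv/= -ler_norml.
have [l [_ ul]] := @segment_compact R (- M) M _ _ uI.
exists l => B lB; have [//|FB] := @in_ultra_setVsetC _ F (u @^-1` B) FU.
by have [x [nBx Bx]] := ul (~` B) B FB lB.
Qed.

Lemma real_part_id (R : realType) : real_part_of (fun x : R => x) idfun.
Proof.
split=> //.
- exact: ler_norm.
- by move=> F u M FU uM; exact: ultra_cvg_bounded_real uM.
- move=> E f fD fZ.
  have flin : linear (f : E -> R^o) by move=> a x y; rewrite fD fZ.
  by exists (HB.pack_for {linear E -> R^o} (f : E -> R^o)
    (GRing.isLinear.Build R E R^o *:%R (f : E -> R^o) flin)).
Qed.

Section Complex.
Context {R : realType}.
Local Notation C := R[i].
Local Notation Re := complex.Re.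
Local Notation Im := complex.Im.
Local Notation c := (real_complex R).

Lemma complex_norm_Re (z : C) : `|z| = c (Re `|z|).
Proof. by rewrite RRe_real// normr_real. Qed.

Lemma normc_ge_Im (z : C) : c `|Im z| <= `|z|.
Proof.
have := normc_ge_Re (z * 'i%C).
rewrite ReiNIm normrN normrM [ `|'i%C| ]normc_def/= expr0n add0r expr1n.
by rewrite sqrtr1 mulr1.
Qed.

Lemma real_complex_cvg (F : set_system nat) (u : nat -> R) (l : R) :
  Filter F -> u n @[n --> F] --> l ->
  (c (u n) : C^o) @[n --> F] --> (c l : C^o).
Proof.
move=> FF /cvgrPdist_lt ul; apply/cvgrPdist_lt => e e0.
have eR : c (Re e) = e by rewrite RRe_real// gtr0_real.
have : 0 < Re e by rewrite -ltcR eR.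
move=> /ul; apply: filterS => n.
by rewrite -rmorphB normc_def/= expr0n addr0 sqrtr_sqr -ltcR eR.
Qed.

Lemma real_part_Re : real_part_of (@complex.Re R) (real_complex R).
Proof.
split=> //.
- by move=> z z0; exact/RRe_real/ger0_real.
- exact: lecR.
- move=> z; rewrite -lecR -complex_norm_Re.
  by apply: le_trans (normc_ge_Re z); rewrite lecR ler_norm.
- move=> F u M FU uM.
  have [a ua] : exists l : R, Re (u n) @[n --> F] --> l.
    apply: (@ultra_cvg_bounded_real _ _ _ M) => n; rewrite -lecR.
    by apply: (le_trans (normc_ge_Re (u n))); exact: uM.
  have [b ub] : exists l : R, Im (u n) @[n --> F] --> l.
    apply: (@ultra_cvg_bounded_real _ _ _ M) => n; rewrite -lecR.
    by apply: (le_trans (normc_ge_Im (u n))); exact: uM.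
  exists (c a + 'i%C * c b).
  have -> : u = (fun n => c (Re (u n)) + 'i%C * c (Im (u n))).
    by apply/funext => n; rewrite -complexE.
  apply: (@cvgD C C^o); first exact: real_complex_cvg.
  by apply: (@cvgM C); [exact: cvg_cst|exact: real_complex_cvg].
- move=> E f fD fZ.
  (* The only linear functional with real part f. *)
  pose g (x : E) : C := Complex (f x) (- f ('i%C *: x)).
  have glin : linear (g : E -> C^o).
    move=> a x y.
    have fC z : f (a *: z) = Re a * f z + Im a * f ('i%C *: z).
      rewrite {1}[a]complexE scalerDl fD [_ * c _]mulrC -scalerA.
      by congr (_ + _); exact: fZ.
    have fN z : f (- z) = - f z.
      by rewrite -scaleN1r -(rmorphN1 c) (fZ (-1)) mulN1r.
    have gD z1 z2 : g (z1 + z2) = g z1 + g z2.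
      by apply/eqP; rewrite /g scalerDr !fD opprD eq_complex /= !eqxx.
    rewrite gD; congr (_ + _); transitivity (a * g x : C); last by [].
    rewrite /g scalerA ['i%C * a]mulrC -scalerA !fC scalerA -expr2 sqr_i.
    rewrite scaleN1r fN; apply/eqP; rewrite eq_complex; case: a {fC} => p q /=.
    by apply/andP; split; apply/eqP; ring.
  by exists (HB.pack_for {linear E -> C^o} (g : E -> C^o)
    (GRing.isLinear.Build C E C^o *:%R (g : E -> C^o) glin)).
Qed.

End Complex.

Theorem theorem4p3 (R : realType) :
  (forall X Y : completeNormedModType R,
     pair_strict_sMstar (fun x : R => x) X Y ->
     weakstar_to_weakstar_MP (fun x : R => x) X Y) /\
  (forall X Y : completeNormedModType R[i],
     pair_strict_sMstar (@complex.Re R) X Y ->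
     weakstar_to_weakstar_MP (@complex.Re R) X Y).
Proof.
split=> X Y; first exact: (strict_sMstar_MP (real_part_id R)).
exact: (strict_sMstar_MP real_part_Re).
Qed.
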